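(* For $n\ge1$ there is a bijection mapping each permutation $\sigma$ of $[n]$ with $k$ exterior peaks to an increasing tree $T$ on $\{0,1,\dots,n\}$ with $j$ nonroot vertices of even degree such that $k=\lfloor (j+1)/2\rfloor$.
   Context: An exterior peak of a permutation $\sigma=\sigma_1\cdots\sigma_n$ of $[n]$ is an index $1\le i\le n$ with $\sigma_{i-1}<\sigma_i>\sigma_{i+1}$, where $\sigma_0=\sigma_{n+1}=0$. An increasing tree on $\{0,1,\dots,n\}$ is a rooted tree with vertex set $\{0,\dots,n\}$, root $0$, in which every child is larger than its parent (children unordered); the degree of a vertex is its number of children. *)

(* Defs.v *)
From HB Require Import structures.
From mathcomp Require Import all_boot all_fingroup.

Set Implicit Arguments.
Unset Strict Implicit.
Unset Printing Implicit Defensive.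

(* A permutation of [n] is an element of 'S_n, i.e. of {perm 'I_n}, with
   positions and values shifted down by 1.  [perm_word s i] is sigma_i in the
   1-based convention; the default value of [nth] gives sigma_i = 0 for i > n,
   in particular for i = n + 1. *)
Definition perm_word (n : nat) (s : 'S_n) (i : nat) : nat :=
  nth 0 (0 :: [seq (s k).+1 | k <- enum 'I_n]) i.

Definition exterior_peak (n : nat) (s : 'S_n) (i : nat) : bool :=
  (perm_word s i.-1 < perm_word s i) && (perm_word s i.+1 < perm_word s i).

Definition nb_exterior_peaks (n : nat) (s : 'S_n) : nat :=
  count (exterior_peak s) (iota 1 n).

(* A rooted tree with unordered children on the vertex type V is given by its
   parent map [p]: [p v = Some u] when u is the parent of v.  The root is the
   only vertex without a parent, and every vertex has it as an ancestor. *)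
Definition is_rooted_tree (V : finType) (r : V) (p : {ffun V -> option V}) :=
  [forall v, (p v == None) == (v == r)] &&
  [forall v, connect (fun x y => p x == Some y) v r].

Definition is_increasing_tree (n : nat)
    (p : {ffun 'I_n.+1 -> option 'I_n.+1}) : bool :=
  is_rooted_tree ord0 p && [forall u, forall v, (p v == Some u) ==> (u < v)].

Record increasing_tree (n : nat) := IncreasingTree {
  parent :> {ffun 'I_n.+1 -> option 'I_n.+1};
  increasing_treeP : is_increasing_tree parent }.

HB.instance Definition _ (n : nat) := [isSub for @parent n].
HB.instance Definition _ (n : nat) := [Finite of increasing_tree n by <:].

Definition degree (n : nat) (T : increasing_tree n) (u : 'I_n.+1) : nat :=
  #|[set v | parent T v == Some u]|.

Definition nb_even_nonroot (n : nat) (T : increasing_tree n) : nat :=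
  #|[set u : 'I_n.+1 | (u != ord0) && ~~ odd (degree T u)]|.

(* Main.v *)
(** Build a permutation of [n+1] by inserting its largest letter into one of
    the n+1 gaps of a permutation of [n], and an increasing tree on
    {0,...,n+1} by attaching the vertex n+1 to one of the n+1 vertices of an
    increasing tree on {0,...,n}.  Let k be the number of exterior peaks,
    respectively (j+1)/2 rounded down.  In both processes exactly 2k of the n+1
    choices keep k and the others raise it by 1: the former are the gaps next to
    a peak, respectively the j even nonroot vertices together with the root when
    j is odd.  Hence both statistics have the same distribution. *)
Require Import Defs.
From mathcomp Require Import all_boot all_fingroup.
From mathcomp Require Import zify.

Set Implicit Arguments.
Unset Strict Implicit.
Unset Printing Implicit Defensive.

(** * Bijections obtained from equal fibre sizes *)

Section FiberMatching.

Variables (A B : finType) (f : A -> nat) (g : B -> nat).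

(** Fibres are matched by rank in their enumerations. Once fibres over the same value have equal
    size, the default [y0] is never returned. *)
Definition fiber_match (y0 : B) (x : A) : B :=
  nth y0 (enum [pred y | g y == f x]) (index x (enum [pred x' | f x' == f x])).

Hypothesis card_fibers :
  forall k, #|[pred x | f x == k]| = #|[pred y | g y == k]|.

Lemma fiber_match_index_lt (x : A) :
  index x (enum [pred x' | f x' == f x]) < size (enum [pred y | g y == f x]).
Proof. by rewrite -cardE -card_fibers cardE index_mem mem_enum inE. Qed.

Lemma fiber_match_stat (y0 : B) (x : A) : g (fiber_match y0 x) = f x.
Proof.
by have := mem_nth y0 (fiber_match_index_lt x); rewrite mem_enum inE => /eqP.
Qed.

End FiberMatching.

Lemma fiber_matchK (A B : finType) (f : A -> nat) (g : B -> nat) x0 y0 :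
  (forall k, #|[pred x | f x == k]| = #|[pred y | g y == k]|) ->
  cancel (fiber_match f g y0) (fiber_match g f x0).
Proof.
move=> fgE x; rewrite {1}/fiber_match (fiber_match_stat fgE) /fiber_match.
rewrite index_uniq ?enum_uniq ?fiber_match_index_lt //.
by rewrite nth_index // mem_enum inE.
Qed.

Lemma equidistributed_bij (A B : finType) (f : A -> nat) (g : B -> nat) :
  A -> B ->
  (forall k, #|[pred x | f x == k]| = #|[pred y | g y == k]|) ->
  exists h : A -> B, bijective h /\ forall x, f x = g (h x).
Proof.
move=> x0 y0 fgE; exists (fiber_match f g y0); split.
  by exists (fiber_match g f x0); apply: fiber_matchK => // k; rewrite fgE.
by move=> x; rewrite fiber_match_stat.
Qed.

(** * Growth processes and the distributions they produce *)

Lemma card_set_sum (I : finType) (P : pred I) : #|[set x | P x]| = \sum_x P x.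
Proof. by rewrite -sum1dep_card big_mkcond; apply: eq_bigr => x _; case: (P x). Qed.

(** [c] is the indicator of the choices that keep the statistic at [k]; all other choices give
    [k.+1], so only the number of kept choices matters. *)
Lemma sum_two_point (m k : nat) (F c : 'I_m -> nat) (phi : nat -> nat) :
  (forall i, c i <= 1) -> (forall i, F i + c i = k + 1) ->
  \sum_i phi (F i) = (\sum_i c i) * phi k + (m - \sum_i c i) * phi k.+1.
Proof.
move=> c_le1 FcE.
have -> : m - \sum_i c i = \sum_i (1 - c i).
  rewrite sumnB => [|i _]; last exact: c_le1.
  by rewrite sum1_card card_ord.
rewrite !big_distrl -big_split; apply: eq_bigr => i _ /=.
have := c_le1 i; have := FcE i.
case: (c i) => [|[|//]] FE _; rewrite ?mul0n ?mul1n ?addn0 ?add0n; congr phi; lia.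
Qed.

(* The operator [phi |-> fun k => 2 k phi(k) + (n+1-2k) phi(k+1)] does not
   depend on the family, which is why quantifying over all weights [phi] makes
   the induction on [n] go through. *)
Lemma growth_sum_eq (A B : nat -> finType)
    (a : forall n, A n -> nat) (b : forall n, B n -> nat)
    (insA : forall n, A n * 'I_n.+1 -> A n.+1)
    (insB : forall n, B n * 'I_n.+1 -> B n.+1)
    (cA : forall n, A n -> 'I_n.+1 -> nat)
    (cB : forall n, B n -> 'I_n.+1 -> nat) :
  #|A 0| = #|B 0| -> (forall x : A 0, a 0 x = 0) -> (forall y : B 0, b 0 y = 0) ->
  (forall n, bijective (@insA n)) -> (forall n, bijective (@insB n)) ->
  (forall n x i, cA n x i <= 1) -> (forall n y i, cB n y i <= 1) ->
  (forall n x i, a n.+1 (insA n (x, i)) + cA n x i = a n x + 1) ->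
  (forall n y i, b n.+1 (insB n (y, i)) + cB n y i = b n y + 1) ->
  (forall n x, \sum_i cA n x i = 2 * a n x) ->
  (forall n y, \sum_i cB n y i = 2 * b n y) ->
  forall n (phi : nat -> nat), \sum_(x : A n) phi (a n x) = \sum_(y : B n) phi (b n y).
Proof.
move=> AB0 a0 b0 bijA bijB cA1 cB1 acE bcE sumA sumB.
elim=> [|n IHn] phi.
  rewrite (eq_bigr (fun=> phi 0)) => [|x _]; last by rewrite a0.
  rewrite [RHS](eq_bigr (fun=> phi 0)) => [|y _]; last by rewrite b0.
  by rewrite !sum_nat_const AB0.
(* The subtraction never truncates where [psi] is evaluated: there [2 * k] is a sum of [n.+1] terms,
   each at most 1. *)
pose psi k := 2 * k * phi k + (n.+1 - 2 * k) * phi k.+1.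
have step (C : nat -> finType) (c : forall n, C n -> nat)
    (ins : C n * 'I_n.+1 -> C n.+1) (d : C n -> 'I_n.+1 -> nat) :
    bijective ins -> (forall x i, d x i <= 1) ->
    (forall x i, c n.+1 (ins (x, i)) + d x i = c n x + 1) ->
    (forall x, \sum_i d x i = 2 * c n x) ->
    \sum_(x : C n.+1) phi (c n.+1 x) = \sum_(x : C n) psi (c n x).
  move=> bij_ins d1 cdE sumd; rewrite (reindex ins) /=; last exact: onW_bij.
  transitivity (\sum_x \sum_i phi (c n.+1 (ins (x, i)))).
    by rewrite pair_bigA; apply: eq_bigr => -[].
  by apply: eq_bigr => x _; rewrite (sum_two_point phi (d1 x) (cdE x)) sumd.
by rewrite (step A a (insA n) (cA n)) // (step B b (insB n) (cB n)) // IHn.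
Qed.

(** * Inserting the largest letter into a word *)

Definition peak (w : nat -> nat) (j : nat) : bool :=
  (w j.-1 < w j) && (w j.+1 < w j).

Definition insert_at (w : nat -> nat) (i M j : nat) : nat :=
  if j <= i then w j else if j == i.+1 then M else w j.-1.

(** The new letter is a peak at position [i.+1] and destroys any peak at its two neighbours, which
    held positions [i] and [i.+1] in the old word. Peaks further left stay in place, and those
    further right move by one. *)
Lemma peak_insert_at (w : nat -> nat) (i M m : nat) :
  w 0 = 0 -> (forall j, w j < M) -> i.+1 < m ->
  \sum_(j < m.+1) peak (insert_at w i M) j + (peak w i + peak w i.+1)
    = \sum_(j < m) peak w j + 1.
Proof.
move=> w0 w_lt lt_im.
have below k : k <= i ->
    \sum_(j < k) peak (insert_at w i M) j = \sum_(j < k) peak w j.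
  move=> le_ki; apply: eq_bigr => j _; rewrite /peak /insert_at.
  have lt_jk := ltn_ord j.
  by rewrite !ifT //; lia.
have at_i : peak (insert_at w i M) i = false.
  rewrite /peak /insert_at leqnn ltnn eqxx; have := w_lt i; lia.
have at_i1 : peak (insert_at w i M) i.+1 = true.
  rewrite /peak /insert_at /= leqnn ltnn eqxx.
  by rewrite !ifF ?w_lt //; lia.
have at_i2 : peak (insert_at w i M) i.+2 = false.
  apply/negP=> /andP[+ _]; rewrite /insert_at /= ltnn eqxx.
  rewrite !ifF ?gtn_eqF //; last lia.
  by rewrite ltnNge ltnW.
have above j : i.+1 < j -> peak (insert_at w i M) j.+1 = peak w j.
  move=> lt_ij; rewrite /peak /insert_at /=.
  by do ![rewrite ifF; last lia].
(* The base case [m = i.+2] contains all the positions touched by the insertion; each further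
   position contributes the same to both sides by [above]. *)
rewrite -(subnKC lt_im); elim: (m - i.+2) => [|d IHd].
  by rewrite addn0 !big_ord_recr /= below // at_i at_i1 at_i2 !addn0 addnAC addnA.
rewrite addnS big_ord_recr [in RHS]big_ord_recr /= above; last lia.
by rewrite addnAC IHd addnAC.
Qed.

Section PermWord.

Variables (n : nat) (s : 'S_n).

Lemma perm_word_ord (k : 'I_n) : perm_word s k.+1 = (s k).+1.
Proof.
by rewrite /perm_word /= (nth_map k) ?size_enum_ord ?ltn_ord // nth_ord_enum.
Qed.

Lemma perm_word_gt (j : nat) : n < j -> perm_word s j = 0.
Proof. by move=> lt_nj; rewrite /perm_word nth_default //= size_map size_enum_ord. Qed.

Lemma perm_word_lt (j : nat) : perm_word s j < n.+1.
Proof.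
case: j => [//|j]; case: (ltnP j n) => [lt_jn | le_nj].
  by rewrite (perm_word_ord (Ordinal lt_jn)) ltnS ltn_ord.
by rewrite perm_word_gt.
Qed.

End PermWord.

Lemma perm_word_lift_perm (n : nat) (s : 'S_n) (i : 'I_n.+1) :
  perm_word (lift_perm i ord_max s) =1 insert_at (perm_word s) i n.+1.
Proof.
case=> [|j]; first by rewrite /insert_at.
rewrite /insert_at; case: (ltnP j n.+1) => [lt_jn | lt_nj]; last first.
  have lt_ij : i < j := leq_trans (ltn_ord i) lt_nj.
  rewrite [LHS]perm_word_gt // !(perm_word_gt s) //; last exact: ltnW.
  by rewrite ltnNge (ltnW lt_ij) eqSS gtn_eqF.
rewrite (perm_word_ord _ (Ordinal lt_jn)).
case: (unliftP i (Ordinal lt_jn)) => [k|] def_j; rewrite def_j; last first.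
  have -> : j = i by rewrite -def_j.
  by rewrite lift_perm_id ltnn eqxx.
have {def_j} -> : j = bump i k by have /= := congr1 val def_j.
rewrite lift_perm_lift lift_max -perm_word_ord /bump.
case: (leqP i k) => [le_ik | lt_ki] /=; last by rewrite add0n lt_ki.
by rewrite add1n ltnNge (leqW le_ik) eqSS gtn_eqF ?ltnS.
Qed.

Lemma nb_exterior_peaksE (n : nat) (s : 'S_n) :
  nb_exterior_peaks s = \sum_(1 <= j < n.+1) peak (perm_word s) j.
Proof.
rewrite /nb_exterior_peaks -sum1_count big_mkcond /index_iota subn1 /=.
by apply: eq_bigr => j _; rewrite /exterior_peak -/(peak _ j); case: (peak _ j).
Qed.

Lemma peak_last (n : nat) (s : 'S_n) : peak (perm_word s) n.+1 = false.
Proof. by rewrite /peak (perm_word_gt _ (ltnSn n)) ltn0. Qed.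

(** The range is widened by positions 0 and [n.+1], which are never peaks, so that every gap has two
    neighbouring positions in it. *)
Lemma peak_sum (n : nat) (s : 'S_n) :
  \sum_(j < n.+2) peak (perm_word s) j = nb_exterior_peaks s.
Proof.
rewrite big_ord_recr /= peak_last addn0.
rewrite nb_exterior_peaksE -(big_mkord xpredT (fun j => peak (perm_word s) j : nat)).
by rewrite big_ltn.
Qed.

Section PermutationGrowth.

Variable n : nat.

Definition insert_max (x : 'S_n * 'I_n.+1) : 'S_n.+1 := lift_perm x.2 ord_max x.1.

Definition adjacent_peaks (s : 'S_n) (i : 'I_n.+1) : nat :=
  peak (perm_word s) i + peak (perm_word s) i.+1.

Lemma insert_max_bij : bijective insert_max.
Proof.
apply: inj_card_bij => [[s i] [t j] /= E|].
  (* The gap is recovered as the position of the largest letter. *)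
  have Eij : i = j.
    apply: (@perm_inj _ (lift_perm j ord_max t)); rewrite lift_perm_id.
    by move: E; rewrite /insert_max /= => <-; rewrite lift_perm_id.
  rewrite -Eij in E *; congr (_, _); apply/permP => k.
  apply: (@lift_inj _ ord_max).
  by rewrite -!(lift_perm_lift i) -[lift_perm _ _ s]/(insert_max (s, i)) E.
by rewrite card_prod !card_Sn card_ord factS mulnC.
Qed.

(** Two consecutive positions cannot both be peaks. *)
Lemma adjacent_peaks_le1 (s : 'S_n) i : adjacent_peaks s i <= 1.
Proof. by rewrite /adjacent_peaks /peak /=; lia. Qed.

Lemma insert_max_peaks (s : 'S_n) i :
  nb_exterior_peaks (insert_max (s, i)) + adjacent_peaks s i
    = nb_exterior_peaks s + 1.
Proof.
have := peak_insert_at (erefl (perm_word s 0)) (perm_word_lt s) (ltn_ord i : i.+1 < n.+2).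
rewrite !peak_sum => <-; rewrite -peak_sum; congr (_ + _); apply: eq_bigr => j _.
by rewrite /peak !perm_word_lift_perm.
Qed.

(** Each peak borders exactly two gaps, the one before it and the one after it. *)
Lemma sum_adjacent_peaks (s : 'S_n) :
  \sum_i adjacent_peaks s i = 2 * nb_exterior_peaks s.
Proof.
rewrite big_split /= mul2n -addnn -peak_sum; congr (_ + _).
  by rewrite [RHS]big_ord_recr /= peak_last addn0.
by rewrite [RHS]big_ord_recl.
Qed.

End PermutationGrowth.

(** * Increasing trees and the attachment of a new largest leaf *)

Lemma is_increasing_treeE (n : nat) (p : {ffun 'I_n.+1 -> option 'I_n.+1}) :
  is_increasing_tree p = [forall v, if p v is Some u then u < v else v == ord0].
Proof.
apply/idP/idP.
  case/andP=> /andP[/forallP pN _] /forallP pS; apply/forallP=> v.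
  case Epv: (p v) => [u|]; last by have := pN v; rewrite Epv eqxx => /eqP <-.
  by have /forallP/(_ v) := pS u; rewrite Epv eqxx.
move/forallP=> pP; apply/andP; split; last first.
  apply/forallP=> u; apply/forallP=> v; apply/implyP=> /eqP Epv.
  by have := pP v; rewrite Epv.
apply/andP; split; apply/forallP=> v.
  have := pP v; case: (p v) => [u|/eqP->]; last by rewrite !eqxx.
  by case: (v =P ord0) => // ->.
(* Parents strictly decrease, so strong induction on the vertex yields a path to the root;
   connectivity thus follows from the local condition. *)
have [m] := ubnP (val v); elim: m v => // m IHm v le_vm.
have := pP v; case Epv: (p v) => [u|] => [lt_uv|/eqP->]; last exact: connect0.
apply: (connect_trans (connect1 _) (IHm u _)); first by rewrite /= Epv.
exact: leq_trans lt_uv _.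
Qed.

Lemma lift_max_eq0 (n : nat) (u : 'I_n.+1) :
  (lift ord_max u == ord0 :> 'I_n.+2) = (u == ord0).
Proof. by rewrite -!val_eqE /= /bump leqNgt ltn_ord. Qed.

Section TreeGrowth.

Variable n : nat.

Definition attach_fun (p : {ffun 'I_n.+1 -> option 'I_n.+1}) (i : 'I_n.+1) :
    {ffun 'I_n.+2 -> option 'I_n.+2} :=
  [ffun v => if unlift ord_max v is Some w then omap (lift ord_max) (p w)
             else Some (lift ord_max i)].

Definition prune_fun (q : {ffun 'I_n.+2 -> option 'I_n.+2}) :
    {ffun 'I_n.+1 -> option 'I_n.+1} :=
  [ffun w => obind (unlift ord_max) (q (lift ord_max w))].

Lemma attach_fun_lift p i w :
  attach_fun p i (lift ord_max w) = omap (lift ord_max) (p w).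
Proof. by rewrite ffunE liftK. Qed.

Lemma attach_fun_max p i : attach_fun p i ord_max = Some (lift ord_max i).
Proof. by rewrite ffunE unlift_none. Qed.

Lemma attach_increasing (T : increasing_tree n) (i : 'I_n.+1) :
  is_increasing_tree (attach_fun T i).
Proof.
have := increasing_treeP T; rewrite !is_increasing_treeE => /forallP pP.
apply/forallP=> v; case: (unliftP ord_max v) => [w|] ->; last first.
  by rewrite attach_fun_max lift_max ltn_ord.
rewrite attach_fun_lift; have := pP w.
case: (parent T w) => [u lt_uw|/eqP->]; last by rewrite /= lift_max_eq0.
by change (lift ord_max u < lift ord_max w); rewrite !lift_max.
Qed.

Lemma prune_increasing (T : increasing_tree n.+1) :
  is_increasing_tree (prune_fun T).
Proof.
have := increasing_treeP T; rewrite !is_increasing_treeE => /forallP qP.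
apply/forallP=> w; rewrite ffunE; have := qP (lift ord_max w).
rewrite lift_max; case: (parent T _) => [u|]; last first.
  by rewrite lift_max_eq0.
rewrite [obind _ _]/=; case: (unliftP ord_max u) => [u'|] ->; rewrite ?lift_max //.
by rewrite /= ltnNge -ltnS (leqW (ltn_ord w)).
Qed.

Definition attach (x : increasing_tree n * 'I_n.+1) : increasing_tree n.+1 :=
  IncreasingTree (attach_increasing x.1 x.2).

Definition detach (T : increasing_tree n.+1) : increasing_tree n * 'I_n.+1 :=
  (IncreasingTree (prune_increasing T),
   odflt ord0 (obind (unlift ord_max) (parent T ord_max))).

Lemma attach_bij : bijective attach.
Proof.
exists detach => [[T i]|T].
  congr (_, _); last by rewrite /= attach_fun_max /= liftK.
  apply: val_inj; apply/ffunP=> w; rewrite /= ffunE attach_fun_lift.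
  by case: (parent T w) => [u|] //=; rewrite liftK.
have := increasing_treeP T; rewrite is_increasing_treeE => /forallP qP.
(* The largest vertex is never a parent. Hence pruning loses no edge, and the default [ord0] in
   [detach] is not reached. *)
have lift_unlift v u : parent T v = Some u ->
    exists2 u', u = lift ord_max u' & unlift ord_max u = Some u'.
  move=> Ev; have := qP v; rewrite Ev.
  case: (unliftP ord_max u) => [u' ->|->] lt_uv; first by exists u'.
  by have /= := ltn_ord v; move: lt_uv => /=; lia.
apply: val_inj; apply/ffunP=> v /=.
case: (unliftP ord_max v) => [w|] ->.
  rewrite attach_fun_lift ffunE.
  case Ew: (parent T _) => [u|] //=.
  by have [u' -> ->] := lift_unlift _ _ Ew.
rewrite attach_fun_max.
case Ev: (parent T ord_max) => [u|] /=.
  by have [u' -> ->] := lift_unlift _ _ Ev.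
by have := qP ord_max; rewrite Ev.
Qed.

End TreeGrowth.

(** * Effect of attaching a leaf on the even nonroot vertices *)

Section TreeStatistic.

Definition half_even (n : nat) (T : increasing_tree n) : nat :=
  (nb_even_nonroot T + 1) %/ 2.

Definition even_nonroot (n : nat) (T : increasing_tree n) (u : 'I_n.+1) : bool :=
  (u != ord0) && ~~ odd (degree T u).

Definition keeps_half_even (n : nat) (T : increasing_tree n) (i : 'I_n.+1) : bool :=
  if i == ord0 then odd (nb_even_nonroot T) else even_nonroot T i.

Variable n : nat.
Implicit Types (T : increasing_tree n) (i u : 'I_n.+1).

Lemma degree_attach_lift T i u :
  degree (attach (T, i)) (lift ord_max u) = degree T u + (u == i).
Proof.
rewrite /degree !card_set_sum (bigD1_ord ord_max) //= attach_fun_max addnC.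
rewrite (inj_eq Some_inj) (inj_eq lift_inj) eq_sym; congr (_ + _).
apply: eq_bigr => w _; rewrite attach_fun_lift.
by case: (parent T w) => [x|] //=; rewrite !(inj_eq Some_inj) (inj_eq lift_inj).
Qed.

Lemma degree_attach_max T i : degree (attach (T, i)) ord_max = 0.
Proof.
apply: eq_card0 => v; rewrite inE; apply/negP=> /eqP Ev.
have := increasing_treeP (attach (T, i)); rewrite is_increasing_treeE.
by move=> /forallP/(_ v); rewrite Ev /=; have /= := ltn_ord v; lia.
Qed.

(** The new leaf has degree 0 and adds one even vertex, while the degree of [i] changes parity. The
    count thus grows by 0 if [i] is an even nonroot vertex, by 2 if it is an odd one, and by 1 if it
    is the root. *)
Lemma nb_even_nonroot_attach T i :
  nb_even_nonroot (attach (T, i)) + 2 * even_nonroot T i + (i == ord0)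
    = nb_even_nonroot T + 2.
Proof.
rewrite /nb_even_nonroot !card_set_sum (bigD1_ord ord_max) //= degree_attach_max /=.
rewrite (bigD1 i) //= [in RHS](bigD1 i) //= degree_attach_lift eqxx.
rewrite (eq_bigr (fun u => even_nonroot T u : nat)) => [|u neq_ui]; last first.
  by rewrite degree_attach_lift (negbTE neq_ui) addn0 lift_max_eq0.
rewrite /even_nonroot lift_max_eq0 addn1 /=.
move: (\sum_(j | _) _) => S.
by case: eqP => _ /=; case: (odd (degree T i)) => /=; lia.
Qed.

Lemma half_even_attach T i :
  half_even (attach (T, i)) + keeps_half_even T i = half_even T + 1.
Proof.
have := nb_even_nonroot_attach T i.
rewrite /half_even /keeps_half_even /even_nonroot; case: eqP => /= _; lia.
Qed.

(** With j even nonroot vertices, j choices come from them and one more from the root when j is odd: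
    j rounded up to an even number. *)
Lemma sum_keeps_half_even T : \sum_i keeps_half_even T i = 2 * half_even T.
Proof.
have nbE : nb_even_nonroot T = \sum_(i < n) even_nonroot T (lift ord0 i).
  by rewrite /nb_even_nonroot card_set_sum big_ord_recl.
rewrite big_ord_recl /= /keeps_half_even /=.
rewrite (eq_bigr (fun i : 'I_n => even_nonroot T (lift ord0 i) : nat)) // -nbE.
rewrite /half_even; lia.
Qed.

End TreeStatistic.

(** * Initial values of both processes, and the conclusion *)

Lemma star_increasing (n : nat) : is_increasing_tree
  [ffun v : 'I_n.+1 => if v == ord0 then None else Some (ord0 : 'I_n.+1)].
Proof.
rewrite is_increasing_treeE; apply/forallP=> v; rewrite ffunE.
by case: eqP => //= /eqP; rewrite -val_eqE /= lt0n.
Qed.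

Lemma card_increasing_tree0 : #|{: increasing_tree 0}| = 1.
Proof.
apply/eqP/card1P; exists (IncreasingTree (star_increasing 0)) => T.
rewrite !inE; apply/esym/eqP/val_inj/ffunP=> v /=.
have := increasing_treeP T; rewrite is_increasing_treeE => /forallP/(_ v).
rewrite ffunE !ord1 eqxx.
by case: (parent T ord0).
Qed.

Lemma half_even0 (T : increasing_tree 0) : half_even T = 0.
Proof.
rewrite /half_even /nb_even_nonroot card_set_sum big1 // => u _.
by rewrite ord1.
Qed.

Theorem theorem5p3 (n : nat) (hn : 1 <= n) :
  exists f : 'S_n -> increasing_tree n,
    bijective f /\
    forall s : 'S_n,
      nb_exterior_peaks s = (nb_even_nonroot (f s) + 1) %/ 2.
Proof.
apply: (@equidistributed_bij _ _ (@nb_exterior_peaks n) (@half_even n)).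
- exact: 1%g.
- exact: IncreasingTree (star_increasing n).
(* Weighting by the indicator of [k] turns the equality of sums into an equality of fibre sizes. *)
move=> k; pose phi m : nat := m == k.
have := @growth_sum_eq (fun m => 'S_m) (fun m => increasing_tree m)
  nb_exterior_peaks half_even insert_max attach adjacent_peaks
  (fun m T i => keeps_half_even T i) _ _ half_even0 insert_max_bij attach_bij
  adjacent_peaks_le1 _ insert_max_peaks half_even_attach sum_adjacent_peaks
  sum_keeps_half_even n phi.
rewrite -!card_set_sum !cardsE; apply.
- by rewrite card_Sn card_increasing_tree0.
- by [].
- by move=> m T i; exact: leq_b1.
Qed.
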